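(* Let $r\geq 3$ and let $T=C_r\,\square\, C_r$ be the $(r\times r)$-dimensional torus. If $r$ is even, then ${\rm ip}_{c}(T)={\rm ip}_{p}(T)=r$. If $r$ is odd, then ${\rm ip}_{c}(T)\in\{r,r+1\}$ and ${\rm ip}_{p}(T)\in\{r,r+1\}$.
   Context: $C_r$ is the cycle on $r$ vertices and $\square$ the Cartesian product. A path is isometric if its length equals the distance between its endpoints; single vertices count as paths. ${\rm ip}_{c}(H)$ (resp. ${\rm ip}_{p}(H)$) is the minimum number of isometric paths of $H$ whose vertex sets cover (resp. partition) $V(H)$. *)

(* Defs.v *)
From mathcomp Require Import all_boot.

Set Implicit Arguments.
Unset Strict Implicit.
Unset Printing Implicit Defensive.

(** Mathematical Components. A graph on a finite vertex type [V] is given by its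
    adjacency relation [e : rel V]. *)

Section IsometricPaths.
Variables (V : finType) (e : rel V).

Definition has_walk (x y : V) (n : nat) : bool :=
  [exists p : n.-tuple V, path e x p && (last x p == y)].

Lemma gdist_ex (x y : V) : exists n, connect e x y ==> has_walk x y n.
Proof.
have [/connectP[p ep ->]|_] := boolP (connect e x y); last by exists 0.
by exists (size p); apply/existsP; exists (in_tuple p); rewrite ep eqxx.
Qed.

(** The length of a shortest walk from [x] to [y]; the value is 0 by convention
    when [x] and [y] lie in different components. *)
Definition gdist (x y : V) : nat := ex_minn (gdist_ex x y).

(** A path is the sequence of its vertices [x :: p]; its length is [size p]. *)
Definition isometric_path (s : seq V) : bool :=
  if s is x :: p then
    [&& path e x p, uniq (x :: p) & size p == gdist x (last x p)]
  else false.

(** A path has at most [#|V|] vertices, so the bounded sequences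
    [#|V|.-bseq V] contain all paths and make families of paths a finite type. *)
Definition isometric_path_cover (P : {set #|V|.-bseq V}) : bool :=
  [forall s in P, isometric_path s] && [forall x, [exists s in P, x \in s]].

Definition isometric_path_partition (P : {set #|V|.-bseq V}) : bool :=
  [forall s in P, isometric_path s] &&
  [forall x, #|[set s in P | x \in s]| == 1].

Lemma isometric_path1 (x : V) : isometric_path [:: x].
Proof.
rewrite /= /gdist; case: ex_minnP => n _ /(_ 0); rewrite leqn0 => n0.
rewrite eq_sym n0 //; apply/implyP => _.
by apply/existsP; exists [tuple]; rewrite /= eqxx.
Qed.

Lemma ip_p_ex : exists k,
  [exists P, isometric_path_partition P && (#|P| == k)].
Proof.
have sz (x : V) : size [:: x] <= #|V| by apply/card_gt0P; exists x.
pose b x : #|V|.-bseq V := Bseq (sz x).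
exists #|[set b x | x : V]|; apply/existsP; exists [set b x | x : V].
rewrite eqxx andbT; apply/andP; split.
  by apply/forall_inP => _ /imsetP[x _ ->]; apply: isometric_path1.
apply/forallP => x; apply/cards1P; exists (b x); apply/setP => s.
rewrite !inE; apply/andP/eqP => [[/imsetP[y _ ->]]|->].
  by rewrite inE => /eqP ->.
by rewrite imset_f // inE.
Qed.

Lemma ip_c_ex : exists k, [exists P, isometric_path_cover P && (#|P| == k)].
Proof.
have [k /existsP[P /andP[/andP[isoP /forallP partP] cardP]]] := ip_p_ex.
exists k; apply/existsP; exists P; rewrite cardP andbT /isometric_path_cover isoP.
apply/forallP => x; have /cards1P[s] := partP x.
move/setP/(_ s); rewrite !inE eqxx => sx.
by apply/existsP; exists s.
Qed.

Definition ip_c : nat := ex_minn ip_c_ex.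
Definition ip_p : nat := ex_minn ip_p_ex.

End IsometricPaths.

(** [ordS] is the successor modulo [r]; this is the cycle on [r] vertices as soon
    as [3 <= r]. *)
Definition cycle_graph (r : nat) : rel 'I_r :=
  fun i j => (j == ordS i) || (i == ordS j).
Arguments cycle_graph : clear implicits.

Definition cartesian_product (V W : finType) (e : rel V) (f : rel W) :
    rel (V * W) :=
  fun x y => ((x.1 == y.1) && f x.2 y.2) || (e x.1 y.1 && (x.2 == y.2)).

Definition torus (r : nat) : rel ('I_r * 'I_r) :=
  cartesian_product (cycle_graph r) (cycle_graph r).
Arguments torus : clear implicits.

(* Main.v *)
(** A shortest path of the torus has at most [2 * (r / 2) + 1 <= r + 1] vertices,
    so [r - 1] of them cover at most [r ^ 2 - 1] vertices. Conversely, walk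
    [r / 2] steps in direction (1, 0) and then [r - 1 - r / 2] steps in direction
    (0, -1): this path is isometric, and the difference of the two coordinates
    takes each value modulo [r] exactly once along it. Hence its [r] translates by
    the diagonal vectors (t, t) partition the torus, whatever the parity of [r]. *)
Require Import Defs.
From mathcomp Require Import all_boot zify.

Set Implicit Arguments.
Unset Strict Implicit.
Unset Printing Implicit Defensive.

(** * Distances and path covers in an arbitrary finite graph *)

Section GraphDistance.
Variables (V : finType) (e : rel V).

Lemma gdist_path_le (x : V) (p : seq V) :
  path e x p -> gdist e x (last x p) <= size p.
Proof.
move=> ep; rewrite /gdist; case: ex_minnP => n _; apply.
by apply/implyP => _; apply/existsP; exists (in_tuple p); rewrite ep eqxx.
Qed.

Lemma gdist_walk (x y : V) : connect e x y ->
  exists p, [/\ path e x p, last x p = y & size p = gdist e x y].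
Proof.
move=> cxy; rewrite /gdist; case: ex_minnP => n; rewrite cxy /= => + _.
by case/existsP=> p /andP[ep /eqP lp]; exists p; rewrite size_tuple.
Qed.

(** Since [d] drops by at most one along an edge, no walk from [x] to [y] is shorter than [d x y];
    the third hypothesis yields a descent reaching [y] in exactly [d x y] steps. *)
Lemma gdistE (d : V -> V -> nat) :
    (forall x, d x x = 0) ->
    (forall x y z, e x z -> d x y <= (d z y).+1) ->
    (forall x y, x != y -> exists2 z, e x z & d x y = (d z y).+1) ->
  forall x y, gdist e x y = d x y.
Proof.
move=> d0 d_edge d_step x y.
have walk n : forall u, d u y = n ->
    exists p, [/\ path e u p, last u p = y & size p = n].
  elim: n => [|n IHn] u du; have [uy|uy] := eqVneq u y.
  - by exists [::].
  - by have [z _] := d_step _ _ uy; rewrite du.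
  - by move: du; rewrite uy d0.
  have [z euz] := d_step _ _ uy; rewrite du => -[/esym/IHn[p [ep lp sp]]].
  by exists (z :: p); rewrite /= euz ep lp sp.
have [p [ep lp sp]] := walk _ x erefl.
have := gdist_path_le ep; rewrite lp sp => le_gd.
apply/eqP; rewrite eqn_leq le_gd /=.
(* Connectedness rules out the default value 0 of [gdist], so a walk [q] realizes the distance. *)
have cxy : connect e x y by apply/connectP; exists p.
have [q [eq <- <-]] := gdist_walk cxy.
elim: q (x) eq => [|z q IHq] u /=; first by rewrite d0.
by case/andP=> euz /IHq dz; apply: leq_trans (d_edge _ _ _ euz) _.
Qed.

Lemma isometric_path_size (D : nat) (s : seq V) :
  (forall x y, gdist e x y <= D) -> isometric_path e s -> size s <= D.+1.
Proof. by move=> leD; case: s => //= x p /and3P[_ _ /eqP->]; rewrite ltnS. Qed.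

(** Double counting of pairs [(x, s)] with [x \in s]: each vertex gives at least one pair, each path
    at most [m]. *)
Lemma cover_card_leq (m : nat) (P : {set #|V|.-bseq V}) :
    (forall s, isometric_path e s -> size s <= m) ->
  isometric_path_cover e P -> #|V| <= #|P| * m.
Proof.
move=> szm /andP[/forall_inP isoP /forallP covP].
rewrite -sum_nat_const -[X in X <= _]sum1_card.
apply: (@leq_trans (\sum_(x : V) \sum_(s in P) (x \in s))).
  apply: leq_sum => x _; have /exists_inP[s sP xs] := covP x.
  by rewrite (bigD1 s) //= xs.
rewrite exchange_big; apply: leq_sum => s sP.
apply: leq_trans (szm _ (isoP _ sP)); rewrite -big_mkcond sum1_card.
exact: card_size.
Qed.

Lemma ip_c_le_ip_p : ip_c e <= ip_p e.
Proof.
rewrite /ip_p; case: ex_minnP => k /existsP[P /andP[/andP[isoP /forallP parP] cP]] _.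
rewrite /ip_c; case: ex_minnP => n _; apply; apply/existsP; exists P.
rewrite cP andbT /isometric_path_cover isoP; apply/forallP => x.
have /cards1P[s] := parP x.
by move/setP/(_ s); rewrite !inE eqxx => sx; apply/existsP; exists s.
Qed.

Lemma ip_p_le (P : {set #|V|.-bseq V}) :
  isometric_path_partition e P -> ip_p e <= #|P|.
Proof.
move=> parP; rewrite /ip_p; case: ex_minnP => n _; apply.
by apply/existsP; exists P; rewrite parP eqxx.
Qed.

Lemma leq_ip_c (m : nat) :
  (forall s, isometric_path e s -> size s <= m) -> #|V| <= ip_c e * m.
Proof.
move=> szm; rewrite /ip_c; case: ex_minnP => n /existsP[P /andP[cP /eqP<-]] _.
exact: cover_card_leq.
Qed.

End GraphDistance.

Lemma path_map_iota (T : Type) (e : rel T) (f : nat -> T) (m n : nat) :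
    (forall i, m <= i < m + n -> e (f i) (f i.+1)) ->
  path e (f m) [seq f i | i <- iota m.+1 n].
Proof.
elim: n m => //= n IHn m ef; rewrite ef ?IHn //; first by move=> i ?; apply: ef; lia.
lia.
Qed.

(* [lia] alone does not split conditionals of type [nat]. *)
Ltac lia_if :=
  repeat match goal with |- context [if ?b then _ else _] =>
    lazymatch b with
    | context [if _ then _ else _] => fail
    | _ => case: (boolP b) => ?
    end
  end; lia.

(** The sums reduced modulo [r] below are all less than [r + r], so each [%%] becomes a conditional
    that [lia_if] can split. *)
Lemma modn_lt_double (r x : nat) :
  x < r + r -> x %% r = if x < r then x else x - r.
Proof.
move=> x2r; case: ltnP => [/modn_small //|rx].
by rewrite -{1}(subnK rx) modnDr modn_small //; lia.
Qed.

(** * Distances in the cycle and the torus, and the lower bound *)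

Section Torus.
Variable r : nat.
Implicit Types i j z : 'I_r.

(** This is [i - j] modulo [r], arranged to avoid truncated subtraction. *)
Definition cycle_offset i j := (i + (r - j)) %% r.

(** The length of the shorter arc between [i] and [j]. *)
Definition cycle_dist i j := minn (cycle_offset i j) (r - cycle_offset i j).

Lemma cycle_offsetE i j :
  cycle_offset i j = if j <= i then i - j else i + r - j.
Proof.
have [ir jr] := (ltn_ord i, ltn_ord j).
by rewrite /cycle_offset modn_lt_double; lia_if.
Qed.

Lemma val_ordS i : ordS i = (if i.+1 < r then i.+1 else 0) :> nat.
Proof. by have ir := ltn_ord i; rewrite /= modn_lt_double; lia_if. Qed.

Lemma cycle_distxx i : cycle_dist i i = 0.
Proof. by rewrite /cycle_dist cycle_offsetE; lia_if. Qed.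

Lemma cycle_dist_half i j : cycle_dist i j <= r./2.
Proof. by rewrite /cycle_dist; lia. Qed.

Lemma cycle_dist_edge i j z :
  cycle_graph r i z -> cycle_dist i j <= (cycle_dist z j).+1.
Proof.
have [[ir jr] zr] := (ltn_ord i, ltn_ord j, ltn_ord z).
by case/orP=> /eqP->; rewrite /cycle_dist !cycle_offsetE val_ordS; lia_if.
Qed.

(** The arc of length [cycle_offset i j] leaves [i] backwards; if it is the shorter one, [z] is the
    predecessor of [i], otherwise the successor. *)
Lemma cycle_dist_step i j : i != j ->
  exists2 z, cycle_graph r i z & cycle_dist i j = (cycle_dist z j).+1.
Proof.
rewrite -val_eqE /= => ij; have [ir jr] := (ltn_ord i, ltn_ord j).
rewrite /cycle_dist; have [le|gt] := leqP (cycle_offset i j) (r - cycle_offset i j).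
  exists (ord_pred i); first by rewrite /cycle_graph ord_predK eqxx orbT.
  have := val_ordS (ord_pred i); have := ltn_ord (ord_pred i).
  rewrite ord_predK; move: (ord_pred i) => z zr.
  by move: le; rewrite !cycle_offsetE; lia_if.
exists (ordS i); first by rewrite /cycle_graph eqxx.
have := val_ordS i; move: (ordS i) => z.
by move: gt; rewrite !cycle_offsetE; lia_if.
Qed.

(** An edge moves a single coordinate, so the sum drops by at most one; a descent step exists in any
    coordinate where [x] and [y] differ. *)
Lemma gdist_torus (x y : 'I_r * 'I_r) :
  gdist (torus r) x y = cycle_dist x.1 y.1 + cycle_dist x.2 y.2.
Proof.
pose d (x y : 'I_r * 'I_r) := cycle_dist x.1 y.1 + cycle_dist x.2 y.2.
apply: (@gdistE _ _ d) => {x y} [x|x y z|x y]; rewrite /d.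
- by rewrite !cycle_distxx.
- case/orP=> /andP[].
    by move/eqP-> => /(cycle_dist_edge y.2); rewrite -addnS leq_add2l.
  by move=> /(cycle_dist_edge y.1) + /eqP->; rewrite -addSn leq_add2r.
case: x y => [x1 x2] [y1 y2] /=; have [<-|x1y1 _] := eqVneq x1 y1.
  rewrite xpair_eqE eqxx => /cycle_dist_step[z ez dz].
  by exists (x1, z); rewrite /torus /cartesian_product /= ?eqxx ?ez // dz; lia.
have [z ez dz] := cycle_dist_step x1y1.
by exists (z, x2); rewrite /torus /cartesian_product /= ?eqxx ?ez ?orbT // dz; lia.
Qed.

Lemma isometric_path_torus_size (s : seq ('I_r * 'I_r)) :
  isometric_path (torus r) s -> size s <= r.+1.
Proof.
apply: isometric_path_size => x y; rewrite gdist_torus.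
by apply: leq_trans (leq_add (cycle_dist_half _ _) (cycle_dist_half _ _)) _; lia.
Qed.

Lemma ip_c_torus_ge : r <= ip_c (torus r).
Proof.
have := leq_ip_c isometric_path_torus_size; rewrite card_prod card_ord.
by rewrite leqNgt; apply: contraNT; rewrite -ltnNge; nia.
Qed.

(** * The partition into translates of a corner path *)

Hypothesis r_gt0 : 0 < r.

Definition torus_vertex (a b : nat) : 'I_r * 'I_r :=
  (Ordinal (ltn_pmod a r_gt0), Ordinal (ltn_pmod b r_gt0)).

(* [r - (k - r./2)] stands for [-(k - r./2)] modulo [r]. *)
Definition corner_vertex (t : 'I_r) (k : nat) : 'I_r * 'I_r :=
  torus_vertex (t + minn k r./2) (t + (r - (k - r./2))).

Definition corner_path (t : 'I_r) : seq ('I_r * 'I_r) :=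
  map (corner_vertex t) (iota 0 r).

Lemma corner_vertex1 t k : k < r ->
  (corner_vertex t k).1 =
    (if t + minn k r./2 < r then t + minn k r./2 else t + minn k r./2 - r) :> nat.
Proof. by move=> kr; have tr := ltn_ord t; rewrite /= modn_lt_double; lia_if. Qed.

Lemma corner_vertex2 t k : k < r ->
  (corner_vertex t k).2 =
    (if t < k - r./2 then t + r - (k - r./2) else t - (k - r./2)) :> nat.
Proof. by move=> kr; have tr := ltn_ord t; rewrite /= modn_lt_double; lia_if. Qed.

(** Invariant under diagonal translation, hence able to recover the position [k] whatever [t] is. *)
Definition corner_index (x : 'I_r * 'I_r) : nat := cycle_offset x.1 x.2.

(** Undoes the steps made in the first coordinate, which recovers [t]. *)
Definition corner_start (x : 'I_r * 'I_r) : 'I_r :=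
  Ordinal (ltn_pmod (x.1 + (r - minn (corner_index x) r./2)) r_gt0).

Lemma corner_index_lt x : corner_index x < r.
Proof. exact: ltn_pmod. Qed.

Lemma val_corner_start x : corner_start x =
  (if minn (corner_index x) r./2 <= x.1 then x.1 - minn (corner_index x) r./2
   else x.1 + r - minn (corner_index x) r./2) :> nat.
Proof. by have xr := ltn_ord x.1; rewrite /= modn_lt_double; lia_if. Qed.

(** The shift [t] cancels in the difference, leaving [minn k r./2 + (k - r./2) = k]. *)
Lemma corner_vertexK t k : k < r -> corner_index (corner_vertex t k) = k.
Proof.
move=> kr; have tr := ltn_ord t; rewrite /corner_index cycle_offsetE.
by rewrite corner_vertex1 // corner_vertex2 //; lia_if.
Qed.

Lemma corner_startK t k : k < r -> corner_start (corner_vertex t k) = t.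
Proof.
move=> kr; have tr := ltn_ord t; apply/ord_inj.
rewrite val_corner_start corner_vertexK //.
by rewrite corner_vertex1 //; lia_if.
Qed.

(** With the two preceding lemmas, [(t, k)] become coordinates on the torus: each vertex lies on
    exactly one corner path. *)
Lemma corner_vertexE x : corner_vertex (corner_start x) (corner_index x) = x.
Proof.
have kr := corner_index_lt x; have sx := val_corner_start x.
have v1 := corner_vertex1 (corner_start x) kr.
have v2 := corner_vertex2 (corner_start x) kr.
have xi : corner_index x = _ := cycle_offsetE _ _.
have [xr1 xr2] := (ltn_ord x.1, ltn_ord x.2).
rewrite [LHS]surjective_pairing [RHS]surjective_pairing.
congr (_, _); apply/ord_inj; move: sx v1 v2 xi; lia_if.
Qed.

Lemma mem_corner_path t x : (x \in corner_path t) = (t == corner_start x).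
Proof.
apply/mapP/eqP => [[k]|->].
  by rewrite mem_iota => /andP[_ kr] ->; rewrite corner_startK.
exists (corner_index x); last by rewrite corner_vertexE.
by rewrite mem_iota corner_index_lt.
Qed.

Lemma corner_path_edge t k : k.+1 < r ->
  torus r (corner_vertex t k) (corner_vertex t k.+1).
Proof.
move=> kr; have tr := ltn_ord t; have kr' := ltnW kr.
rewrite /torus /cartesian_product /cycle_graph.
(* From position [r./2] on, the second coordinate decreases, so its cycle edge is read backwards;
   before that, the first one increases. *)
have [turned|straight] := leqP r./2 k; apply/orP; [left|right]; apply/andP; split.
- by apply/eqP/ord_inj; rewrite !corner_vertex1 //; lia_if.
- by apply/orP; right; apply/eqP/ord_inj; rewrite val_ordS !corner_vertex2 //; lia_if.
- by apply/orP; left; apply/eqP/ord_inj; rewrite val_ordS !corner_vertex1 //; lia_if.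
- by apply/eqP/ord_inj; rewrite !corner_vertex2 //; lia_if.
Qed.

(** Each leg has length at most [r./2], so it is a shortest arc in its own coordinate; the two
    distances add up to [r.-1], the length of the path. *)
Lemma isometric_corner_path t : isometric_path (torus r) (corner_path t).
Proof.
have uniqP : uniq (corner_path t).
  rewrite map_inj_in_uniq ?iota_uniq // => k l; rewrite !mem_iota /= => kr lr.
  by move/(congr1 corner_index); rewrite !corner_vertexK.
have def_path : corner_path t =
    corner_vertex t 0 :: map (corner_vertex t) (iota 1 r.-1).
  have iotaS : iota 0 r = 0 :: iota 1 r.-1 by have := r_gt0; case: (r).
  by rewrite /corner_path iotaS.
move: uniqP; rewrite def_path => uniqP; apply/and3P; split=> //.
  by apply: path_map_iota => k kr; apply: corner_path_edge; lia.
have -> : last (corner_vertex t 0) (map (corner_vertex t) (iota 1 r.-1))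
    = corner_vertex t r.-1.
  rewrite last_map; congr corner_vertex.
  by rewrite (last_nth 0) size_iota -[0 :: _]/(iota 0 r.-1.+1) nth_iota.
have r1 : r.-1 < r by lia.
have tr := ltn_ord t.
have dist1 : cycle_dist (corner_vertex t 0).1 (corner_vertex t r.-1).1 = r./2.
  have -> : (corner_vertex t 0).1 = t.
    by apply/ord_inj; rewrite corner_vertex1 //; lia_if.
  have := corner_vertex1 t r1; move: (corner_vertex t r.-1).1 => a.
  have half : minn r.-1 r./2 = r./2 by lia.
  by rewrite half /cycle_dist cycle_offsetE; lia_if.
have dist2 : cycle_dist (corner_vertex t 0).2 (corner_vertex t r.-1).2 = r.-1 - r./2.
  have -> : (corner_vertex t 0).2 = t.
    by apply/ord_inj; rewrite corner_vertex2 //; lia_if.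
  have := corner_vertex2 t r1; move: (corner_vertex t r.-1).2 => b.
  by rewrite /cycle_dist cycle_offsetE; lia_if.
by rewrite size_map size_iota gdist_torus dist1 dist2; lia.
Qed.

Lemma size_corner_path t : size (corner_path t) <= #|{: 'I_r * 'I_r}|.
Proof. by rewrite size_map size_iota card_prod card_ord leq_pmulr. Qed.

Definition corner_bseq t : #|{: 'I_r * 'I_r}|.-bseq ('I_r * 'I_r) :=
  Bseq (size_corner_path t).

Lemma corner_partition :
  isometric_path_partition (torus r) [set corner_bseq t | t : 'I_r].
Proof.
apply/andP; split.
  by apply/forall_inP => _ /imsetP[t _ ->]; apply: isometric_corner_path.
apply/forallP => x; apply/cards1P; exists (corner_bseq (corner_start x)).
apply/setP => s; rewrite !inE; apply/andP/eqP => [[/imsetP[t _ ->]]|->].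
  by rewrite [_ \in _]mem_corner_path => /eqP->.
by rewrite imset_f // [_ \in _]mem_corner_path.
Qed.

Lemma ip_p_torus_le : ip_p (torus r) <= r.
Proof.
apply: leq_trans (ip_p_le corner_partition) _.
by apply: leq_trans (leq_imset_card _ _) _; rewrite card_ord.
Qed.

End Torus.

Theorem theorem8 (r : nat) (hr : 3 <= r) :
  (~~ odd r -> ip_c (torus r) = r /\ ip_p (torus r) = r) /\
  (odd r ->
     (ip_c (torus r) = r \/ ip_c (torus r) = r.+1) /\
     (ip_p (torus r) = r \/ ip_p (torus r) = r.+1)).
Proof.
have r_gt0 : 0 < r by apply: leq_trans hr.
have ge_c := ip_c_torus_ge r; have c_le_p := ip_c_le_ip_p (torus r).
have p_le := ip_p_torus_le r_gt0.
(* The chain [r <= ip_c <= ip_p <= r] forces equality for both parities; the odd case takes the left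
   alternatives. *)
have -> : ip_c (torus r) = r by lia.
have -> : ip_p (torus r) = r by lia.
by split=> _; split; try left.
Qed.
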